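(* Let $G$ be a graph and let $t$ be a fixed positive integer. Then $\operatorname{th}_+(G) \leq t$ if and only if there exist integers $a, k > 0$ and $b \geq 0$ such that $a + b = t$ and $G$ can be obtained from the Cartesian product $K_a \square T_{k,b}$ by contracting tree edges and/or deleting complete edges.
   Context: All graphs are finite, simple and undirected (multiple edges created by a contraction are replaced by a single edge). PSD zero forcing: vertices are blue or white. If $B$ is the current set of blue vertices of $G$ and $W_1,\dots,W_m$ are the vertex sets of the connected components of $G-B$, a blue vertex $u$ can force a white vertex $w$ to become blue (written $u\to w$) if, for some $i$, $w$ is the only white neighbor of $u$ in $G[B\cup W_i]$. For $B\subseteq V(G)$ initially blue (all other vertices white), a chronological list of PSD forces of $B$ is an ordered list of valid forces performed consecutively until no further force is possible; the set of forces in such a list is called a set of PSD forces of $B$. For a set $\mathcal F$ of PSD forces of $B$, let $\mathcal F^{(0)}=B$ and let $\mathcal F^{(s+1)}$ be the set of white vertices $w$ such that some $(u\to w)\in\mathcal F$ is a valid PSD force when exactly $\bigcup_{i=0}^{s}\mathcal F^{(i)}$ is blue. Let $\operatorname{pt}_+(G;\mathcal F)$ be the least $s$ with $\bigcup_{i=0}^{s}\mathcal F^{(i)}=V(G)$ ($\infty$ if there is none), and $\operatorname{pt}_+(G;B)=\min_{\mathcal F}\operatorname{pt}_+(G;\mathcal F)$ over all sets $\mathcal F$ of PSD forces of $B$. The PSD throttling number is $\operatorname{th}_+(G)=\min_{B\subseteq V(G)}\big(|B|+\operatorname{pt}_+(G;B)\big)$. For integers $k>0$ and $b\ge 0$, $T_{k,b}$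 is the rooted tree of height $b$ in which every vertex of depth less than $b$ has exactly $k$ children. In $K_a\square T_{k,b}$, the tree edges are the edges in the copies of $T_{k,b}$, and the complete edges are the edges in the copies of $K_a$. *)

(* Defs.v *)
From HB Require Import structures.
From mathcomp Require Import all_boot.
From mathcomp Require Import boolp.

Set Implicit Arguments.
Unset Strict Implicit.
Unset Printing Implicit Defensive.

Record sgraph := SGraph {
  svertex :> finType;
  adj : rel svertex;
  adj_sym : symmetric adj;
  adj_irrefl : irreflexive adj }.
Arguments adj {s}.

(* The least natural number satisfying P; None plays the role of infinity. *)
Definition least (P : nat -> Prop) : option nat :=
  if pselect (exists n, `[< P n >]) is left exP then Some (ex_minn exP)
  else None.

Lemma least_SomeP (P : nat -> Prop) n :
  least P = Some n <-> P n /\ (forall m, P m -> n <= m).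
Proof.
rewrite /least; case: pselect => [exP|nP].
- case: ex_minnP => m /asboolP Pm minm; split=> [[<-]|[Pn minn]].
    by split=> // j /asboolP; apply: minm.
  congr Some; apply/eqP; rewrite eqn_leq minn // andbT.
  by apply: minm; apply/asboolP.
- by split=> // -[Pn _]; case: nP; exists n; apply/asboolP.
Qed.

Lemma least_NoneP (P : nat -> Prop) :
  least P = None <-> (forall n, ~ P n).
Proof.
rewrite /least; case: pselect => [exP|nP]; split=> //.
- by have [n /asboolP Pn] := exP => /(_ n).
- by move=> _ n Pn; apply: nP; exists n; apply/asboolP.
Qed.

Section PSDForcing.
Variable G : sgraph.
Implicit Types (B W : {set G}) (F : {set G * G}) (s : seq (G * G)).

Definition white_adj B : rel G :=
  [rel x y | [&& x \notin B, y \notin B & adj x y]].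

(* Vertex sets of the connected components of G - B. *)
Definition white_components B : {set {set G}} :=
  equivalence_partition (connect (white_adj B)) (~: B).

Definition psd_force B (u w : G) : bool :=
  (u \in B) &&
  [exists W in white_components B,
     [set x in (B :|: W) :\: B | adj u x] == [set w]].

Fixpoint chron_list B s : Prop :=
  if s is (u, w) :: s' then psd_force B u w /\ chron_list (w |: B) s'
  else forall u w, ~~ psd_force B u w.

Definition psd_force_set B F : Prop :=
  exists2 s, chron_list B s & F = [set f in s].

Definition next_layer F B : {set G} :=
  [set w | [exists u, ((u, w) \in F) && psd_force B u w]].

(* The union of the first layers F^(0), ..., F^(n), see blue_afterE. *)
Fixpoint blue_after F B n : {set G} :=
  if n is n'.+1 then
    blue_after F B n' :|: next_layer F (blue_after F B n')
  else B.

Definition layer F B n : {set G} :=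
  if n is n'.+1 then next_layer F (blue_after F B n') else B.

Lemma blue_afterE F B n : blue_after F B n = \bigcup_(i < n.+1) layer F B i.
Proof.
elim: n => [|n IHn]; first by rewrite big_ord_recr big_ord0 /= set0U.
by rewrite big_ord_recr /= -IHn.
Qed.

Definition pt_force_set F B : option nat :=
  least (fun n => blue_after F B n = [set: G]).

Definition pt_plus B : option nat :=
  least (fun n => exists2 F, psd_force_set B F & pt_force_set F B = Some n).

Lemma pt_plus_setT : pt_plus [set: G] = Some 0.
Proof.
apply/least_SomeP; split=> //; exists set0.
- exists [::]; last by apply/setP => f; rewrite !inE.
  move=> u w; apply/negP => /andP[_ /exists_inP[W _ /eqP/setP/(_ w)]].
  by rewrite !inE eqxx.
- by apply/least_SomeP.
Qed.

Definition throttles (n : nat) : Prop :=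
  exists B m, pt_plus B = Some m /\ n = #|B| + m.

(* Starting with all vertices blue, the minimum is taken over finite values. *)
Lemma throttles_ex : exists n, `[< throttles n >].
Proof.
exists (#|[set: G]| + 0); apply/asboolP; exists [set: G], 0.
by split; first exact: pt_plus_setT.
Qed.

Definition th_plus : nat := ex_minn throttles_ex.

End PSDForcing.

Section CompleteGraph.
Variable a : nat.

Definition complete_adj : rel 'I_a := [rel i j | i != j].

Lemma complete_adj_sym : symmetric complete_adj.
Proof. by move=> i j; rewrite /complete_adj /= eq_sym. Qed.

Lemma complete_adj_irrefl : irreflexive complete_adj.
Proof. by move=> i; rewrite /complete_adj /= eqxx. Qed.

Definition complete_graph : sgraph :=
  SGraph complete_adj_sym complete_adj_irrefl.

End CompleteGraph.

(* The vertices of T_{k,b} are the words of length at most b over k letters: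
   the root is the empty word, the depth of a vertex is its length, and the
   children of y are the words obtained by appending one letter to y. *)
Section KaryTree.
Variables k b : nat.

Definition tree_child (x y : b.-bseq 'I_k) : bool :=
  [exists c : 'I_k, x == rcons y c :> seq 'I_k].

Definition tree_adj : rel (b.-bseq 'I_k) :=
  [rel x y | tree_child x y || tree_child y x].

Lemma tree_adj_sym : symmetric tree_adj.
Proof. by move=> x y; rewrite /tree_adj /= orbC. Qed.

Lemma tree_adj_irrefl : irreflexive tree_adj.
Proof.
move=> x; rewrite /tree_adj /= orbb; apply/existsP => -[c /eqP/(congr1 size)].
by rewrite size_rcons => /n_Sn.
Qed.

Definition kary_tree : sgraph := SGraph tree_adj_sym tree_adj_irrefl.

End KaryTree.

(* A graph whose vertices form a subset of V and whose edges carry one of two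
   labels; it remembers, while edges are contracted and deleted, which edges
   come from tree edges and which from complete edges. *)
Record tcgraph (V : finType) := TCGraph {
  tc_vertices : {set V};
  tree_edge : rel V;
  complete_edge : rel V }.

(* The Cartesian product of H1 and H2; its complete edges are the edges of the
   copies of H1, its tree edges those of the copies of H2. *)
Definition box_product (H1 H2 : sgraph) : tcgraph (H1 * H2)%type :=
  TCGraph [set: H1 * H2]
    [rel x y | (x.1 == y.1) && adj x.2 y.2]
    [rel x y | adj x.1 y.1 && (x.2 == y.2)].

Section Operations.
Variable V : finType.
Implicit Types (H K : tcgraph V) (e : rel V).

(* Every edge at v is moved to u; loops are dropped, and parallel edges merge
   since e is a relation. *)
Definition redirect (u v : V) e : rel V :=
  let merge z := if z == v then u else z in
  [rel x y | (x != y) &&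
     [exists x', exists y', [&& e x' y', merge x' == x & merge y' == y]]].

Definition contract H (u v : V) : tcgraph V :=
  TCGraph (tc_vertices H :\ v)
    (redirect u v (tree_edge H)) (redirect u v (complete_edge H)).

Definition delete_complete H (u v : V) : tcgraph V :=
  TCGraph (tc_vertices H) (tree_edge H)
    [rel x y | complete_edge H x y &&
       ~~ (((x == u) && (y == v)) || ((x == v) && (y == u)))].

Inductive reduces_to H : tcgraph V -> Prop :=
| reduces_refl : reduces_to H H
| reduces_contract K u v :
    reduces_to H K -> tree_edge K u v -> reduces_to H (contract K u v)
| reduces_delete K u v :
    reduces_to H K -> complete_edge K u v ->
    reduces_to H (delete_complete K u v).

Definition isomorphic_to (G : sgraph) H : Prop :=
  exists f : G -> V,
    [/\ injective f, f @: [set: G] = tc_vertices H &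
        forall x y : G,
          adj x y = tree_edge H (f x) (f y) || complete_edge H (f x) (f y)].

End Operations.

Definition obtained_from (V : finType) (G : sgraph) (H : tcgraph V) : Prop :=
  exists2 K, reduces_to H K & isomorphic_to G K.

(* Main.v *)
(* PSD forcing is monotone: a valid force stays valid when more vertices are
   blue.  Hence th_plus G <= t only asks for an increasing sequence of sets D s
   that exhausts G, in which each new vertex of D (s + 1) is forced from D s.

   Contracting tree edges and deleting complete edges of K_a [] T amounts to a
   map f onto V(G) with connected fibres inside the copies of T, such that tree
   edges become edges or loops and every edge of G is the image of an edge.
   Given f, the images of the words of length at most s form such a sequence,
   because a white component at time s only involves words below a single node
   of depth s + 1.  Conversely, given the sequence, the nodes of depth s are
   read as chains of nested white components at times 0, ..., s - 1, and each
   initial blue vertex labels its copy of T by following its forces down the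
   branches.  If u and v are adjacent and u turns blue first, the chain of v
   extends that of u, and u keeps the nodes on the way down to v unless it
   forces v itself; so uv comes from a complete edge or from a tree edge. *)
Require Import Defs.
From mathcomp Require Import all_boot.
From mathcomp Require Import boolp.

Set Implicit Arguments.
Unset Strict Implicit.
Unset Printing Implicit Defensive.

(** * PSD forcing along increasing sequences of blue sets *)

Section Forcing.
Variable G : sgraph.
Implicit Types (B C : {set G}) (u v w : G).

Lemma connect_white_sym B : connect_sym (white_adj B).
Proof. by apply: sym_connect_sym => x y; rewrite /white_adj /= adj_sym andbCA. Qed.

Lemma connect_white_out B x y :
  connect (white_adj B) x y -> x \notin B -> y \notin B.
Proof.
case/connectP=> p + ->; elim: p x => //= z p IHp x /andP[/and3P[_ zB _] pth] _.
exact: IHp pth zB.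
Qed.

Lemma psd_forceP B u w :
  reflect [/\ u \in B, w \notin B, adj u w &
             forall v, connect (white_adj B) w v -> adj u v -> v = w]
          (psd_force B u w).
Proof.
apply: (iffP andP) => [[uB /exists_inP[W /imsetP[x xB ->] /eqP eqw]]|].
- have := set11 w; rewrite -eqw !inE => /andP[/andP[wB]].
  rewrite (negPf wB) /= => xw uw.
  split=> // v wv uv; apply/set1P; rewrite -eqw !inE uv andbT.
  have vB := connect_white_out wv wB.
  by rewrite (negPf vB); apply: connect_trans xw wv.
- case=> uB wB uw only; split=> //; apply/exists_inP.
  exists [set y in ~: B | connect (white_adj B) w y].
    by apply/imsetP; exists w; rewrite ?inE.
  apply/eqP/setP => v; rewrite !inE; apply/idP/eqP => [|->].
    by case/andP=> /andP[vB]; rewrite (negPf vB) /= => wv; apply: only.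
  by rewrite wB uw connect0 orbT.
Qed.

(** A path avoiding [C] avoids [B], so the white component of [w] only shrinks. *)
Lemma psd_force_mono B C u w :
  B \subset C -> w \notin C -> psd_force B u w -> psd_force C u w.
Proof.
move=> BC wC /psd_forceP[uB wB uw only].
apply/psd_forceP; split=> // [|v wv]; first exact: (subsetP BC).
apply: only; apply: connect_sub wv => x y /and3P[xC yC xy].
by apply: connect1; rewrite /white_adj /= xy !(contraNN (subsetP BC _)).
Qed.

Definition forcing_sequence (D : nat -> {set G}) : Prop :=
  forall s, D s \subset D s.+1 /\
    forall w, w \in D s.+1 -> w \notin D s -> exists u, psd_force (D s) u w.

Lemma forcing_sequence_sub (D : nat -> {set G}) s r :
  forcing_sequence D -> s <= r -> D s \subset D r.
Proof.
move=> fD; apply: (homo_leq (r := fun B C => B \subset C)) => [||n].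
- by move=> B.
- by move=> B C E; apply: subset_trans.
by case: (fD n).
Qed.

Lemma blue_after_sequence (F : {set G * G}) B : forcing_sequence (blue_after F B).
Proof.
move=> s; split=> [|w]; first exact: subsetUl.
by rewrite /= inE => /orP[->//|]; rewrite inE => /existsP[u /andP[_ fu]] _; exists u.
Qed.

(** The vertices of [D s.+1] outside [X] turn blue one at a time; by monotonicity a force valid from
    [D s] is still valid from the intermediate set [X]. *)
Lemma chron_list_step (D : nat -> {set G}) s (X : {set G}) l :
  D s \subset X -> X \subset D s.+1 -> forcing_sequence D -> chron_list (D s.+1) l ->
  exists2 l', chron_list X l' &
    {subset l <= l'} /\ forall w, w \in D s.+1 -> w \notin X ->
      exists2 u, (u, w) \in l' & psd_force (D s) u w.
Proof.
move=> sX XsD fD cl.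
elim: {X}_.+1 {-2}X (ltnSn #|~: X|) sX XsD => // n IHn X cX sX XsD.
have [/subsetP sub|] := boolP (D s.+1 \subset X).
  have -> : X = D s.+1 by apply/eqP; rewrite eqEsubset XsD; apply/subsetP.
  by exists l => //; split=> // w ->.
case/subsetPn=> w wD wX.
have [u fu] : exists u, psd_force (D s) u w.
  by apply: (fD s).2 => //; apply: contra wX; apply: subsetP.
have [|||l' cl' [sub fl']] := IHn (w |: X).
- by rewrite -ltnS; apply: leq_trans cX; rewrite (cardsD1 w (~: X)) inE wX setCU setIC -setDE.
- by rewrite (subset_trans sX) // subsetUr.
- by rewrite subUset sub1set wD.
exists ((u, w) :: l').
  by split=> //; apply: psd_force_mono fu.
split=> [f /sub|w' w'D w'X]; first by rewrite inE orbC => ->.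
have [->|ww'] := eqVneq w' w; first by exists u => //; rewrite mem_head.
have [||u' u'l fu'] := fl' w' => //; first by rewrite !inE negb_or ww'.
by exists u' => //; rewrite inE u'l orbT.
Qed.

(** The list is built from its end: the forces of step [s] are put in front of a list that starts at
    [D s.+1]. *)
Lemma chron_list_sequence (D : nat -> {set G}) n s :
  forcing_sequence D -> D (s + n) = [set: G] ->
  exists2 l, chron_list (D s) l &
    forall r w, s <= r -> w \in D r.+1 -> w \notin D r ->
      exists2 u, (u, w) \in l & psd_force (D r) u w.
Proof.
move=> fD; elim: n s => [|n IHn] s.
  rewrite addn0 => DT; exists [::] => [u w|r w sr _].
    by rewrite DT; apply/negP => /psd_forceP[]; rewrite !inE.
  by move=> /negP[]; apply: (subsetP (forcing_sequence_sub fD sr)); rewrite DT inE.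
rewrite addnS -addSn => /IHn[l cl fl].
have [l' cl' [sub fl']] := chron_list_step (subxx _) (fD s).1 fD cl.
exists l' => // r w; rewrite leq_eqVlt => /predU1P[<-|sr]; first exact: fl'.
by move=> wD wND; have [u /sub ul fu] := fl r w sr wD wND; exists u.
Qed.

Lemma least_le (P : nat -> Prop) n : P n -> exists2 m, least P = Some m & m <= n.
Proof.
move=> Pn; case E: (least P) => [m|]; last by have /least_NoneP/(_ n) := E.
by exists m => //; have /least_SomeP[_] := E; apply.
Qed.

Lemma th_plus_leP t : th_plus G <= t <->
  exists D b, [/\ forcing_sequence D, D b = [set: G] & #|D 0| + b <= t].
Proof.
rewrite /th_plus; case: ex_minnP => m /asboolP[B [n [ptB ->]]] minm; split.
- move=> le_t; have /least_SomeP[[F _ /least_SomeP[FT _]] _] := ptB.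
  by exists (blue_after F B), n; split=> //; apply: blue_after_sequence.
- case=> D [b [fD DT]]; apply: leq_trans.
  have [l cl fl] := chron_list_sequence (s := 0) fD DT.
  pose F := [set f in l].
  (* Run with [F], the process may get ahead of [D] but, by monotonicity, never falls behind. *)
  have subF r : D r \subset blue_after F (D 0) r.
    elim: r => [|r IHr]; first exact: subxx.
    apply/subsetP => w wD /=; rewrite !inE.
    have [//|wN] := boolP (w \in blue_after F (D 0) r).
    have wND: w \notin D r by apply: contra wN; apply: (subsetP IHr).
    have [u ul fu] := fl r w isT wD wND.
    by apply/existsP; exists u; rewrite inE ul (psd_force_mono IHr).
  have FT : blue_after F (D 0) b = [set: G].
    by apply/eqP; rewrite eqEsubset subsetT -DT subF.
  have [c cE cb] := least_le (P := fun n => blue_after F (D 0) n = [set: G]) FT.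
  have [|d dE dc] := @least_le
      (fun n => exists2 F, psd_force_set (D 0) F & pt_force_set F (D 0) = Some n) c.
    by exists F => //; exists l.
  apply: (@leq_trans (#|D 0| + d)); last by rewrite leq_add2l (leq_trans dc).
  by apply: minm; apply/asboolP; exists (D 0), d.
Qed.

End Forcing.

(** * Contractions and deletions as maps with connected fibres *)

Lemma connect_homo (T T' : finType) (e : rel T) (e' : rel T') (f : T -> T') :
  (forall x y, e x y -> connect e' (f x) (f y)) ->
  forall x y, connect e x y -> connect e' (f x) (f y).
Proof.
move=> fe x y /connectP[p + ->]; elim: p x => [|z p IHp] x /=; first by rewrite connect0.
by case/andP=> /fe xz /IHp; apply: connect_trans.
Qed.

Definition fiber_edge (V : finType) (T : eqType) (e : rel V) (f : V -> T) : rel V :=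
  [rel x y | e x y && (f x == f y)].

Section Contraction.
Variable V : finType.
Implicit Types (H K : tcgraph V) (e : rel V).

Lemma fiber_edge_connect_sym (T : eqType) e (f : V -> T) :
  symmetric e -> connect_sym (fiber_edge e f).
Proof.
by move=> se; apply: sym_connect_sym => x y; rewrite /fiber_edge /= se eq_sym.
Qed.

Lemma redirectP u v e x y :
  reflect (x != y /\ exists x' y', [/\ e x' y',
             (if x' == v then u else x') = x & (if y' == v then u else y') = y])
          (redirect u v e x y).
Proof.
apply: (iffP andP) => -[xy].
  by case/existsP=> x' /existsP[y' /and3P[exy /eqP ex /eqP ey]]; split=> //; exists x', y'.
case=> x' [y' [exy ex ey]]; split=> //; apply/existsP; exists x'.
by apply/existsP; exists y'; rewrite exy ex ey !eqxx.
Qed.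

(** [r] sends each vertex to the one that has absorbed it. Complete edges get one implication only,
    since they may be deleted. *)
Record retraction H K (r : V -> V) : Prop := Retraction {
  retr_in : forall p, r p \in tc_vertices K;
  retr_id : {in tc_vertices K, forall p, r p = p};
  retr_connect : forall p q, r p = r q -> connect (fiber_edge (tree_edge H) r) p q;
  retr_tree : forall x y, tree_edge K x y <->
    x != y /\ exists p q, [/\ tree_edge H p q, r p = x & r q = y];
  retr_complete : forall x y, complete_edge K x y ->
    exists p q, [/\ complete_edge H p q, r p = x & r q = y] }.

Lemma reduces_to_retraction H K :
  tc_vertices H = [set: V] -> symmetric (tree_edge H) -> irreflexive (tree_edge H) ->
  reduces_to H K -> exists r, retraction H K r.
Proof.
move=> HT sH iH.
elim=> {K} [|K u v _ [r [rin rid rcon rtree rcomp]] uv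
               |K u v _ [r [rin rid rcon rtree rcomp]] _].
- exists id; split=> // [p|p q ->|x y|x y xy]; first by rewrite HT inE.
  + exact: connect0.
  + split=> [xy|[_ [p [q [? <- <-]]]] //]; split; last by exists x, y.
    by apply: contraTneq xy => ->; rewrite iH.
  + by exists x, y.
- have [uNv [p0 [q0 [pq0 pu qv]]]] := (rtree u v).1 uv.
  pose m z := if z == v then u else z.
  exists (m \o r); split=> /= [p|p|p q|x y|x y].
  + rewrite /m; case: eqP => [_|/eqP pv]; last by rewrite !inE pv rin.
    by rewrite !inE uNv -pu rin.
  + by rewrite /m !inE => /andP[pv /rid->]; rewrite (negPf pv).
  + have sub z w : r z = r w -> connect (fiber_edge (tree_edge H) (m \o r)) z w.
      move/rcon; apply: connect_sub => x y /andP[xy /eqP exy].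
      by apply: connect1; rewrite /fiber_edge /= xy exy eqxx.
    have csym := @fiber_edge_connect_sym _ (tree_edge H) (m \o r) sH.
    (* The contraction fuses the fibres over [u] and [v], which the tree edge from [p0] to [q0]
       joins; so the whole new fibre is connected to [q0]. *)
    have toq z : m (r z) = u -> connect (fiber_edge (tree_edge H) (m \o r)) z q0.
      rewrite {1}/m; case: eqP => [zv _|_ zu]; first by apply: sub; rewrite zv.
      apply: (@connect_trans _ _ p0); first by apply: sub; rewrite zu.
      by apply: connect1; rewrite /fiber_edge /= pq0 pu qv /m eqxx (negPf uNv) eqxx.
    have [pu' pq|pu'] := eqVneq (m (r p)) u.
      by apply: (@connect_trans _ _ q0); [apply: toq | rewrite csym; apply: toq; rewrite -pq].
    move=> pq; apply: sub; move: pu' pq; rewrite /m.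
    have [_|_] := eqVneq (r p) v; first by rewrite eqxx.
    by have [_ /eqP|] := eqVneq (r q) v.
  + split=> [/redirectP[xy [x' [y' [/rtree[_ [p [q [pq <- <-]]]] ex ey]]]]|].
      by split=> //; exists p, q.
    case=> xy [p [q [pq ex ey]]]; apply/redirectP; split=> //.
    exists (r p), (r q); split=> //; apply/rtree; split; last by exists p, q.
    by apply: contraNneq xy => e; rewrite -ex -ey e.
  + case/redirectP=> xy [x' [y' [/rcomp[p [q [pq <- <-]]] ex ey]]].
    by exists p, q.
- by exists r; split=> //= x y /andP[/rcomp].
Qed.

(** A complete edge may have any image, since it can be deleted. *)
Record contraction_map (G : sgraph) H (f : V -> G) : Prop := ContractionMap {
  contr_surj : forall g, exists p, f p = g;
  contr_connect : forall p q, f p = f q -> connect (fiber_edge (tree_edge H) f) p q;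
  contr_tree : forall p q, tree_edge H p q -> f p = f q \/ adj (f p) (f q);
  contr_adj : forall g h, adj g h ->
    exists p q, [/\ tree_edge H p q || complete_edge H p q, f p = g & f q = h] }.

(** [f] is the retraction followed by the inverse of the isomorphism. *)
Lemma obtained_from_contraction_map (G : sgraph) H :
  tc_vertices H = [set: V] -> symmetric (tree_edge H) -> irreflexive (tree_edge H) ->
  obtained_from G H -> exists f : V -> G, contraction_map H f.
Proof.
move=> HT sH iH [K /(reduces_to_retraction HT sH iH)[r [rin rid rcon rtree rcomp]]].
case=> g [ginj gim gadj].
have /choice[f fK] p : exists x, g x = r p.
  have := rin p; rewrite -gim => /imsetP[x _ ->]; by exists x.
have f_r p q : f p = f q -> r p = r q by rewrite -!fK => ->.
exists f; split=> [x|p q|p q pq|x y].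
- exists (g x); apply: ginj; rewrite fK rid // -gim; exact: imset_f.
- move=> pq; have := rcon _ _ (f_r _ _ pq); apply: connect_sub => a b /andP[ab /eqP rab].
  apply: connect1; rewrite /fiber_edge /= ab /=; apply/eqP; apply: ginj.
  by rewrite !fK.
- have [e|ne] := eqVneq (f p) (f q); [by left | right].
  rewrite gadj !fK; apply/orP; left; apply/rtree; split; last by exists p, q.
  by rewrite -!fK (inj_eq ginj).
- rewrite gadj => /orP[/rtree[_]|/rcomp] [p [q [pq ex ey]]]; exists p, q;
  by rewrite pq ?orbT; split=> //; apply: ginj; rewrite fK.
Qed.

(** The invariant for reading operations off [f]: [f] stays fixed while [K] loses vertices and
    edges. *)
Record partial_contraction (G : sgraph) (f : V -> G) K : Prop := PartialContraction {
  pcontr_surj : forall g, exists2 p, p \in tc_vertices K & f p = g;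
  pcontr_connect : {in tc_vertices K &, forall p q,
    f p = f q -> connect (fiber_edge (tree_edge K) f) p q};
  pcontr_tree : forall p q, tree_edge K p q ->
    [/\ p \in tc_vertices K, q \in tc_vertices K, p != q & f p = f q \/ adj (f p) (f q)];
  pcontr_complete : forall p q, complete_edge K p q ->
    p \in tc_vertices K /\ q \in tc_vertices K;
  pcontr_adj : forall g h, adj g h ->
    exists p q, [/\ tree_edge K p q || complete_edge K p q, f p = g & f q = h] }.

Definition sound_complete (G : sgraph) (f : V -> G) K : Prop :=
  forall p q, complete_edge K p q -> adj (f p) (f q).

Lemma partial_contraction_delete (G : sgraph) (f : V -> G) H K :
  reduces_to H K -> partial_contraction f K ->
  exists K', [/\ reduces_to H K', partial_contraction f K' & sound_complete f K'].
Proof.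
pose bad K := [set pq : V * V | complete_edge K pq.1 pq.2 && ~~ adj (f pq.1) (f pq.2)].
elim: {K}_.+1 {-2}K (ltnSn #|bad K|) => // n IHn K cK HK pK.
have [bad0|[[p q]]] := set_0Vmem (bad K).
  exists K; split=> // p q pq; apply: contraT => npq.
  by have := in_set0 (p, q); rewrite -bad0 !inE pq npq.
rewrite !inE /= => /andP[pq npq].
have le : bad (delete_complete K p q) \subset bad K :\ (p, q).
  apply/subsetP => -[x y]; rewrite !inE /= => /andP[/andP[-> nxy] ->]; rewrite !andbT.
  by apply: contra nxy => /eqP[-> ->]; rewrite !eqxx.
apply: IHn (reduces_delete HK pq) _.
  rewrite -ltnS; apply: leq_trans cK; rewrite ltnS (cardsD1 (p, q) (bad K)).
  by rewrite !inE /= pq npq ltnS subset_leq_card.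
case: pK => surj con tree comp eadj; split=> // [x y /andP[/comp]//|g h gh].
have [x [y [xy fx fy]]] := eadj g h gh; exists x, y; split=> //=.
case/orP: xy => [->//|->]; rewrite orbC /=; apply/orP; left.
(* The deleted edge is never the witness for an edge of [G], because its ends have non-adjacent
   images. *)
apply: contra npq => /orP[]/andP[/eqP<- /eqP<-]; by rewrite fx fy // adj_sym.
Qed.

(** Each contraction removes a vertex, and [f] survives it because the contracted edge lies inside a
    fibre. *)
Lemma partial_contraction_contract (G : sgraph) (f : V -> G) H K :
  reduces_to H K -> partial_contraction f K -> sound_complete f K ->
  exists K', [/\ reduces_to H K', partial_contraction f K', sound_complete f K' &
                 {in tc_vertices K' &, injective f}].
Proof.
elim: {K}_.+1 {-2}K (ltnSn #|tc_vertices K|) => // n IHn K cK HK pK sK.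
have [inj|] := pselect {in tc_vertices K &, injective f}; first by exists K.
move=> /existsNP[p] /existsNP[q] /not_implyP[pK1] /not_implyP[qK] /not_implyP[fpq].
move=> /eqP pq.
(* Two vertices with the same image are joined by a tree path in their fibre; its first edge gets
   contracted. *)
have [u [v [uv fuv]]] : exists u v, tree_edge K u v /\ f u = f v.
  case/connectP: (pcontr_connect pK pK1 qK fpq) pq => -[|z s] /=.
    by move=> _ ->; rewrite eqxx.
  by case/andP=> /andP[pz /eqP fpz] _ _ _; exists p, z.
have [uK vK uNv _] := pcontr_tree pK uv.
pose m z := if z == v then u else z.
have fm z : f (m z) = f z by rewrite /m; case: eqP => // ->.
have mK z : z \in tc_vertices K -> m z \in tc_vertices K :\ v.
  by move=> zK; rewrite !inE /m; have [_|zv] := eqVneq z v; rewrite ?uNv // zv.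
have mid z : z \in tc_vertices K :\ v -> m z = z.
  by rewrite !inE /m => /andP[/negPf->].
apply: IHn (reduces_contract HK uv) _ _.
- by rewrite -ltnS; apply: leq_trans cK; rewrite (cardsD1 v (tc_vertices K)) vK.
- case: pK => surj con tree comp eadj; split=> /= [g|x y|x y|x y|g h gh].
  + have [x xK <-] := surj g; by exists (m x); rewrite ?mK.
  + move=> xK yK fxy; rewrite -(mid x xK) -(mid y yK).
    move: (xK) (yK); rewrite !inE => /andP[_ xK'] /andP[_ yK'].
    apply: connect_homo (con _ _ xK' yK' fxy) => a b /andP[ab /eqP fab].
    have [->|mab] := eqVneq (m a) (m b); first exact: connect0.
    apply: connect1; rewrite /fiber_edge /= !fm fab eqxx andbT.
    by apply/redirectP; split=> //; exists a, b.
  + case/redirectP=> xy [a [b [/tree[aK bK _ ab] ea eb]]].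
    by rewrite -ea -eb; split; rewrite ?mK // ?fm // /m ea eb.
  + by case/redirectP=> _ [a [b [/comp[aK bK] <- <-]]]; split; apply: mK.
  + have [a [b [ab fa fb]]] := eadj g h gh.
    have mab : m a != m b.
      by apply: contraTneq gh => /(congr1 f); rewrite !fm fa fb => ->; rewrite adj_irrefl.
    exists (m a), (m b); rewrite !fm; split=> //.
    case/orP: ab => ab; apply/orP; [left|right]; apply/redirectP; split=> //;
      by exists a, b.
- move=> x y /redirectP[_ [a [b [/sK ab <- <-]]]]; by rewrite !fm.
Qed.

Lemma contraction_map_obtained_from (G : sgraph) H (f : V -> G) :
  tc_vertices H = [set: V] -> irreflexive (tree_edge H) ->
  contraction_map H f -> obtained_from G H.
Proof.
move=> HT iH [surj con tree eadj].
have pH : partial_contraction f H.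
  split=> // [g|p q _ _|p q pq|p q _]; [|exact: con| |by rewrite HT !inE].
    by have [p <-] := surj g; exists p; rewrite ?HT ?inE.
  rewrite HT !inE; split=> //; last exact: tree.
  by apply: contraTneq pq => ->; rewrite iH.
have [K1 [HK1 pK1 sK1]] := partial_contraction_delete (reduces_refl H) pH.
have [K [HK [surjK conK treeK compK eadjK] sK inj]] :=
  partial_contraction_contract HK1 pK1 sK1.
exists K => //.
have /choice[g gK] x : exists p, p \in tc_vertices K /\ f p = x.
  by have [p] := surjK x; exists p.
have gf p : p \in tc_vertices K -> g (f p) = p.
  by move=> pK; apply: inj; rewrite ?(gK _).1 ?(gK _).2.
exists g; split=> [x y /(congr1 f)||].
- by rewrite !(gK _).2.
- apply/setP=> p; apply/imsetP/idP => [[x _ ->]|pK]; first exact: (gK x).1.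
  by exists (f p); rewrite ?gf.
- move=> x y; apply/idP/orP => [/eadjK[p [q [pq <- <-]]]|[xy|/sK]].
  + by case/orP: pq => pq; [left; have [pK qK _ _] := treeK _ _ pq
                          | right; have [pK qK] := compK _ _ pq]; rewrite !gf.
  + have [_ _ gxy] := treeK _ _ xy; rewrite !(gK _).2 => -[exy|//].
    by rewrite exy eqxx in gxy.
  + by rewrite !(gK _).2.
Qed.

End Contraction.

(** * From a contraction map to a forcing sequence *)

Lemma connect_invariant (T : finType) (S : Type) (e : rel T) (h : T -> S) :
  (forall x y, e x y -> h x = h y) -> forall x y, connect e x y -> h x = h y.
Proof.
move=> eh x y /connectP[p + ->]; by elim: p x => //= z p IHp x /andP[/eh-> /IHp].
Qed.

Section Product.
Variables (G : sgraph) (a k b : nat).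
Local Notation node := (b.-bseq 'I_k).
Local Notation prod := (box_product (complete_graph a) (kary_tree k b)).
Implicit Types (x y : node).

Lemma product_tree_edge (p q : 'I_a * node) :
  tree_edge prod p q = (p.1 == q.1) && tree_adj p.2 q.2.
Proof. by []. Qed.

Lemma product_complete_edge (p q : 'I_a * node) :
  complete_edge prod p q = (p.1 != q.1) && (p.2 == q.2).
Proof. by []. Qed.

Lemma product_tree_sym : symmetric (tree_edge prod).
Proof. by move=> p q; rewrite !product_tree_edge eq_sym tree_adj_sym. Qed.

Lemma product_tree_irrefl : irreflexive (tree_edge prod).
Proof. by move=> p; rewrite product_tree_edge tree_adj_irrefl andbF. Qed.

Lemma tree_adj_take s x y : tree_adj x y -> s <= size x -> s <= size y ->
  take s x = take s y.
Proof.
by case/orP=> /existsP[c /eqP->] ? ?; rewrite -cats1 takel_cat.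
Qed.

(** The words with prefix [z] form the subtree rooted at [z], which can only be left through its
    root. *)
Lemma tree_adj_cross (z : seq 'I_k) x y :
  tree_adj x y -> take (size z) x = z -> take (size z) y <> z -> x = z :> seq 'I_k.
Proof.
move=> xy xz yz; have zx : size z <= size x by rewrite -{1}xz size_take_min geq_minr.
have zy : size y < size z.
  by rewrite ltnNge; apply/negP => zy; apply: yz; rewrite -(tree_adj_take xy).
case/orP: xy => /existsP[c /eqP e].
- by rewrite -xz take_oversize // e size_rcons.
- by move: zy; rewrite e size_rcons ltnNge (leqW zx).
Qed.

Lemma contraction_map_copy (f : 'I_a * node -> G) p q :
  contraction_map prod f -> f p = f q -> p.1 = q.1.
Proof.
move=> cf /(contr_connect cf); apply: connect_invariant => {p q} p q.
by case/andP=> /andP[/eqP].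
Qed.

Lemma th_plus_contraction_map (f : 'I_a * node -> G) :
  contraction_map prod f -> th_plus G <= a + b.
Proof.
move=> cf; have [surj con tree eadj] := cf.
pose D s := f @: [set p : 'I_a * node | size p.2 <= s].
have inD s i x : size x <= s -> f (i, x) \in D s.
  by move=> xs; apply: imset_f; rewrite inE.
have notinD s p : f p \notin D s -> s < size p.2.
  by case: p => i x; rewrite ltnNge; apply: contra; apply: inD.
apply/th_plus_leP; exists D, b; split; last 2 first.
- apply/setP => v; rewrite inE; have [[i x] <-] := surj v.
  by rewrite inD // size_bseq.
- rewrite leq_add2r (leq_trans (leq_imset_card _ _)) //.
  rewrite (@leq_trans #|[set (i, [bseq] : node) | i in [set: 'I_a]]|) //; last first.
    by rewrite (leq_trans (leq_imset_card _ _)) // cardsT card_ord.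
  apply/subset_leq_card/subsetP => -[i x]; rewrite inE leqn0 => /nilP x0.
  by apply/imsetP; exists i => //; congr pair; apply: val_inj.
move=> s; split.
  by apply: imsetS; apply/subsetP => p; rewrite !inE => /leqW.
move=> w /imsetP[[i z] + ->{w}] wN; rewrite inE => /= zs.
have {}zs : size z = s.+1 by apply/eqP; rewrite eqn_leq zs (notinD _ _ wN).
(* Dropping the last letter of [z] gives its parent [x]; the vertex forcing [w] will be
   [f (i, x)]. *)
have [x [c zx]] : exists x c, z = rcons x c :> seq 'I_k.
  have [r [c E]] : exists r c, z = rcons r c :> seq 'I_k.
    by case/lastP: (bseqval z) zs => // r c _; exists r, c.
  have rb : size r <= b by rewrite -ltnS -(size_rcons r c) -E (leqW (size_bseq z)).
  by exists (Bseq rb), c.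
have xs : size x = s by move: zs; rewrite zx size_rcons => -[].
have uD : f (i, x) \in D s by rewrite inD // xs.
have uw : f (i, x) != f (i, z) by apply: contraNneq wN => <-.
exists (f (i, x)); apply/psd_forceP; split=> //.
  case: (tree (i, x) (i, z)) => [|/eqP|//]; last by rewrite (negPf uw).
  rewrite product_tree_edge eqxx; apply/orP; right.
  by apply/existsP; exists c; rewrite zx.
have /choice[g fg] := surj.
(* Outside [D s] all preimages of [v] are longer than [s], and the connectedness of the fibre makes
   their prefixes of length [s.+1] agree: the label does not depend on [g]. *)
pose lab v := take s.+1 (g v).2.
have labE p : f p \notin D s -> take s.+1 p.2 = lab (f p).
  pose h q := if f q \in D s then [::] else take s.+1 q.2.
  have hE q r : fiber_edge (tree_edge prod) f q r -> h q = h r.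
    case/andP=> qr /eqP fqr; rewrite /h -fqr; case: ifPn => // qN.
    move: qr; rewrite product_tree_edge => /andP[_ qr].
    by rewrite (tree_adj_take qr) ?notinD // -fqr.
  move=> pN; have := connect_invariant hE (con _ _ (esym (fg (f p)))).
  by rewrite /h fg (negPf pN).
move=> v wv uv.
have vN := connect_white_out wv wN.
(* Both kinds of edges keep this prefix, so the label is constant on the white component of [w]. *)
have lab_v : lab v = z.
  transitivity (lab (f (i, z))); last by rewrite -labE // take_oversize ?zs.
  apply/esym; apply: connect_invariant wv => v1 v2 /and3P[v1N v2N].
  case/eadj=> p [q [pq ep eq]]; subst v1 v2; rewrite -!labE //.
  case/orP: pq; rewrite (product_tree_edge, product_complete_edge).
    by case/andP=> _ pq; rewrite (tree_adj_take pq) ?notinD.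
  by case/andP=> _ /eqP->.
have [p [q [pq fp fq]]] := eadj _ _ uv.
have qz : take s.+1 q.2 = z by rewrite labE fq.
have pi : p.1 = i by rewrite -[RHS]/((i, x).1); apply: (contraction_map_copy cf).
(* The fibre of [f (i, x)] cannot enter the subtree below [z]: it would contain [(i, z)], whose
   image is [w]. *)
have pz : take s.+1 p.2 <> z.
  pose h r := [&& f r == f (i, x), r.1 == i & take s.+1 r.2 == z].
  have hE m r : fiber_edge (tree_edge prod) f m r -> h m -> h r.
    case/andP=> qr /eqP fqr; rewrite /h -fqr => /and3P[/eqP fqx qi /eqP qz'].
    move: qr; rewrite product_tree_edge => /andP[/eqP q1 qr].
    rewrite fqx eqxx -q1 qi /=; apply: contraT => /eqP rz.
    have qz2 : m.2 = z by apply: val_inj; apply: tree_adj_cross qr _ _; rewrite zs.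
    by case/eqP: uw; rewrite -fqx -qz2 -(eqP qi) -surjective_pairing.
  have hE' m r : fiber_edge (tree_edge prod) f m r -> h m = h r.
    move=> qr; apply/idP/idP; first exact: hE.
    apply: hE; case/andP: qr => mr fmr; apply/andP.
    by split; [rewrite product_tree_sym | rewrite eq_sym].
  move=> pz; have := connect_invariant hE' (con _ _ fp).
  rewrite /h fp pi pz !eqxx /= => /esym/eqP/(congr1 size).
  by rewrite size_take_min xs zs => /eqP; rewrite (minn_idPr (leqnSn s)) ltn_eqF.
(* The edge from [p] to [q] enters this subtree. A complete edge keeps the word, and a tree edge
   enters only at [z], so [v] is [w]. *)
move: pq; rewrite product_tree_edge product_complete_edge.
case/orP=> /andP[/eqP]; last by move=> _ /eqP epq; case: pz; rewrite epq.
rewrite tree_adj_sym => pq1 pq; rewrite -fq [q]surjective_pairing -pq1 pi.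
by congr (f (_, _)); apply: val_inj; apply: tree_adj_cross pq _ _; rewrite zs.
Qed.

End Product.

(** * From a forcing sequence to a contraction map *)

Section Unfolding.
(** [tau w] is the time when [w] turns blue and [par w] its forcer; initial vertices are their own
    parents. *)
Variables (G : sgraph) (tau : G -> nat) (par : G -> G) (b : nat).
Local Notation blue s := [set v : G | tau v <= s].
Hypothesis par_root : forall w, tau w = 0 -> par w = w.
Hypothesis par_force : forall w, 0 < tau w -> psd_force (blue (tau w).-1) (par w) w.
Hypothesis tau_le : forall w, tau w <= b.
Implicit Types (u v w i : G) (x : seq 'I_#|G|).

(* The tree node of depth m that v lies below: the chain of components containing v of
   the white graphs at times 0, ..., m - 1, each one encoded by its canonical
   representative. *)
Definition component_word m v : seq 'I_#|G| :=
  mkseq (fun s => enum_rank (root (white_adj (blue s)) v)) m.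

(** The node where [v] takes over from its parent, or the root if [v] is initially blue. *)
Definition birth_word v := component_word (tau v) v.

Lemma size_birth_word v : size (birth_word v) = tau v.
Proof. exact: size_mkseq. Qed.

Lemma component_word_adj m u v : adj u v -> m <= tau u -> m <= tau v ->
  component_word m u = component_word m v.
Proof.
move=> uv mu mv; apply/eq_in_map => s; rewrite mem_iota /= => sm.
congr enum_rank; apply/eqP; rewrite root_connect; last exact: connect_white_sym.
by apply: connect1; rewrite /white_adj /= uv !inE -!ltnNge !(leq_trans sm).
Qed.

Lemma par_adj w : 0 < tau w -> adj (par w) w.
Proof. by case/par_force/psd_forceP. Qed.

Lemma tau_par w : 0 < tau w -> tau (par w) < tau w.
Proof.
by move=> w0; have /psd_forceP[] := par_force w0; rewrite inE => ?; rewrite -[ltnRHS]prednK.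
Qed.

(** The last letter of the birth word names the component at time [(tau w).-1], in which [par w] has
    no neighbour but [w]. *)
Lemma forced_unique v w : 0 < tau w -> adj (par w) v ->
  birth_word w = component_word (tau w) v -> v = w.
Proof.
move=> w0; have /psd_forceP[_ _ _ only] := par_force w0.
move=> wv; rewrite /birth_word -(prednK w0) /component_word !mkseqS.
move/rcons_inj=> [_ /enum_rank_inj/eqP].
by rewrite root_connect => [wv'|]; [exact: only | exact: connect_white_sym].
Qed.

(** The word is reversed so that the recursion removes its last letter. By default [v] keeps the
    node, when it forces no vertex born there. *)
Fixpoint occupant_rev i (r : seq 'I_#|G|) : G :=
  if r is c :: r' then
    let v := occupant_rev i r' in
    odflt v [pick w | (par w == v) && (rev r == birth_word w)]
  else i.

(* The vertex that holds the node x in the copy of the tree belonging to i: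
   moving down the tree, a vertex is replaced by the one it forces in the
   current component. *)
Definition occupant i x := occupant_rev i (rev x).

Lemma occupant_rcons i x c :
    occupant i (rcons x c) = occupant i x /\
      (forall w, par w = occupant i x -> rcons x c <> birth_word w) \/
    par (occupant i (rcons x c)) = occupant i x /\
      rcons x c = birth_word (occupant i (rcons x c)).
Proof.
rewrite /occupant rev_rcons /= rev_cons revK; case: pickP => /= [w|no].
  by case/andP=> /eqP ? /eqP ?; right.
by left; split=> // w pw e; have := no w; rewrite pw e !eqxx.
Qed.

(** A vertex replacing [u] on the way down to [v] would be forced by [u] in the component of [v], so
    it is [v] by [forced_unique]. *)
Lemma occupant_walk i u v m : adj u v -> occupant i (birth_word u) = u ->
  tau u <= m <= tau v ->
  occupant i (component_word m v) =
    if [&& m == tau v, par v == u & 0 < m] then v else u.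
Proof.
move=> uv iu; elim: m => [|m IHm] /andP[um mv].
  have u0 : tau u = 0 by apply/eqP; rewrite -leqn0.
  by rewrite !andbF -[RHS]iu /birth_word u0.
(* If [m < tau u], then [tau u = m.+1] and the walk starts here, at the birth node of [u]. *)
have [um'|um'] := ltnP m (tau u).
  have eum : tau u = m.+1 by apply/eqP; rewrite eqn_leq um.
  rewrite -(component_word_adj uv) ?eum // -eum iu.
  case: ifP => // /and3P[/eqP e /eqP p u0].
  by have := @tau_par v; rewrite -e p ltnn => /(_ u0).
have := IHm; rewrite um' (ltnW mv) (ltn_eqF mv) /= => /(_ isT) IH.
rewrite /component_word mkseqS -/(component_word m v).
have := occupant_rcons i (component_word m v) (enum_rank (root (white_adj (blue m)) v)).
rewrite IH -mkseqS -/(component_word m.+1 v) andbT.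
case=> [[-> no]|[pw ew]].
  case: ifP => // /andP[/eqP e /eqP p]; case: (no v p).
  by rewrite /birth_word -e.
have ew' := congr1 size ew; rewrite size_birth_word size_mkseq in ew'.
have evw : v = occupant i (component_word m.+1 v).
  by apply: forced_unique; rewrite ?pw // -ew' // -ew.
by rewrite -!evw in pw ew' *; rewrite ew' pw !eqxx.
Qed.

(** As [tau] is at most [b] and drops at each step until it is 0, [b] steps reach an initial
    vertex. *)
Definition ancestor := iter b par.

Lemma tau_iter_par n w : tau (iter n par w) <= tau w - n.
Proof.
elim: n => [|n IHn] /=; first by rewrite subn0.
rewrite subnS; have [z|/tau_par lt] := posnP (tau (iter n par w)).
  by rewrite par_root // z.
by rewrite -ltnS; apply: leq_trans lt (leq_trans IHn (leqSpred _)).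
Qed.

Lemma tau_ancestor w : tau (ancestor w) = 0.
Proof. by apply/eqP; rewrite -leqn0 (leq_trans (tau_iter_par b w)) // leqn0 subn_eq0. Qed.

Lemma ancestor_par w : ancestor (par w) = ancestor w.
Proof. by rewrite /ancestor -iterSr iterS par_root // tau_ancestor. Qed.

Lemma ancestor_root i : tau i = 0 -> ancestor i = i.
Proof. by move=> i0; rewrite /ancestor iter_fix // par_root. Qed.

(** Induction on [tau v]: the parent holds its own birth node, and [occupant_walk] leads from there
    to [v]. *)
Lemma occupant_birth_word v : occupant (ancestor v) (birth_word v) = v.
Proof.
elim: {v}(tau v) {-2}v (leqnn (tau v)) => [|n IHn] v vn; have [v0|v0] := posnP (tau v).
- by rewrite ancestor_root // /birth_word v0.
- by move: vn; rewrite leqNgt v0.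
- by rewrite ancestor_root // /birth_word v0.
rewrite (@occupant_walk _ (par v)) ?eqxx ?v0 ?par_adj //.
- by rewrite -ancestor_par IHn // -ltnS (leq_trans (tau_par v0)).
- by rewrite leqnn ltnW ?tau_par.
Qed.

(** Each new occupant is forced by the previous one, so the ancestor never changes. *)
Lemma ancestor_occupant i x : tau i = 0 -> ancestor (occupant i x) = i.
Proof.
move=> i0; elim/last_ind: x => [|x c IHx]; first exact: ancestor_root.
by case: (occupant_rcons i x c) => [[-> //]|[pw _]]; rewrite -ancestor_par pw.
Qed.

Local Notation a := #|blue 0|.
Local Notation node := (b.-bseq 'I_#|G|).
Local Notation prod := (box_product (complete_graph a) (kary_tree #|G| b)).

(** One copy per initial vertex; the arity is [#|G|] because letters encode vertices representing
    components. *)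
Definition unfolding (p : 'I_a * node) : G := occupant (enum_val p.1) p.2.

Lemma tau_enum_val (j : 'I_a) : tau (enum_val j) = 0.
Proof. by have := enum_valP j; rewrite inE leqn0 => /eqP. Qed.

Lemma ancestor_index v : exists j : 'I_a, enum_val j = ancestor v.
Proof.
have v0 : ancestor v \in blue 0 by rewrite inE tau_ancestor.
by exists (enum_rank_in v0 (ancestor v)); rewrite enum_rankK_in.
Qed.

Lemma component_word_le v m : m <= tau v -> size (component_word m v) <= b.
Proof. by rewrite size_mkseq => /leq_trans; apply. Qed.

Definition birth_node v : node := Bseq (component_word_le (leqnn (tau v))).

Lemma bseq_rcons (x : node) n : size x = n.+1 ->
  exists (y : node) c, size y = n /\ x = rcons y c :> seq 'I_#|G|.
Proof.
move=> xn; have [r [c E]] : exists r c, x = rcons r c :> seq 'I_#|G|.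
  by case/lastP: (bseqval x) xn => // r c _; exists r, c.
have rn : size r = n by apply: succn_inj; rewrite -xn E size_rcons.
have rb : size r <= b by rewrite rn ltnW // -xn size_bseq.
by exists (Bseq rb), c.
Qed.

(** Moving up one node keeps the occupant unless the node is its birth node, so the path up to there
    stays in the fibre. *)
Lemma unfolding_connect (p : 'I_a * node) :
  connect (fiber_edge (tree_edge prod) unfolding) (p.1, birth_node (unfolding p)) p.
Proof.
case: p => j x /=; move: {2}(size x) (erefl (size x)) => n.
elim: n x => [|n IHn] x xn.
  have x0 : x = [bseq] by apply: val_inj; apply: size0nil.
  rewrite x0; set y := birth_node _; suff -> : y = [bseq] by exact: connect0.
  apply: val_inj; apply: size0nil; rewrite size_birth_word; exact: tau_enum_val.
have [y [c [yn xy]]] := bseq_rcons xn.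
have := occupant_rcons (enum_val j) y c; rewrite -xy.
rewrite -[occupant _ x]/(unfolding (j, x)) -[occupant _ y]/(unfolding (j, y)).
case=> [[exy _]|[_ e]].
  rewrite exy; apply: connect_trans (IHn y yn) _; apply: connect1.
  apply/andP; split; last by rewrite /= exy.
  rewrite /= eqxx; apply/orP; right; apply/existsP; exists c; exact/eqP.
by have -> : birth_node (unfolding (j, x)) = x by apply: val_inj.
Qed.

Lemma unfolding_child (j : 'I_a) (x y : node) : tree_child x y ->
  unfolding (j, x) = unfolding (j, y) \/ adj (unfolding (j, x)) (unfolding (j, y)).
Proof.
case/existsP=> c /eqP xy; rewrite /unfolding /= xy.
case: (occupant_rcons (enum_val j) y c) => [[-> _]|[<- e]]; [by left | right].
by rewrite adj_sym par_adj // -size_birth_word -e size_rcons.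
Qed.

(** If [u] forces [v], a tree edge enters the birth node of [v]. Otherwise [u], in its own copy,
    still holds that node, and a complete edge joins the two copies. *)
Lemma unfolding_adj u v : adj u v -> tau u <= tau v ->
  exists p q, [/\ tree_edge prod p q || complete_edge prod p q,
                  unfolding p = u & unfolding q = v].
Proof.
move=> uv le_uv; have [[j ej] [l el]] := (ancestor_index u, ancestor_index v).
have walk m : tau u <= m <= tau v -> occupant (enum_val j) (component_word m v) =
    if [&& m == tau v, par v == u & 0 < m] then v else u.
  by apply: occupant_walk => //; rewrite ej occupant_birth_word.
have := walk (tau v); rewrite le_uv leqnn eqxx /= => /(_ isT).
case: ifP => [/andP[/eqP pv v0]|_] ouv.
  have vb : (tau v).-1 <= tau v by apply: leq_pred.
  exists (j, Bseq (component_word_le vb)), (j, birth_node v); split=> //.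
    rewrite /= eqxx; apply/orP; left; apply/orP; right.
    apply/existsP; exists (enum_rank (root (white_adj (blue (tau v).-1)) v)).
    by rewrite /= /component_word -mkseqS prednK.
  rewrite /unfolding /= walk; last by rewrite leq_pred -ltnS prednK // -pv tau_par.
  by rewrite ltn_eqF // prednK.
exists (j, birth_node v), (l, birth_node v); split=> //; last first.
  by rewrite /unfolding /= el occupant_birth_word.
rewrite /= eqxx andbT; apply/orP; right.
(* In a single copy the node would have both [u] and [v] as its occupant. *)
apply: contraTneq uv => jl; suff -> : u = v by rewrite adj_irrefl.
by rewrite -ouv jl el occupant_birth_word.
Qed.

Lemma unfolding_contraction_map : contraction_map prod unfolding.
Proof.
split=> [v|p q pq|p q|u v uv].
- have [j ej] := ancestor_index v; exists (j, birth_node v).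
  by rewrite /unfolding /= ej occupant_birth_word.
- have epq : p.1 = q.1.
    apply: enum_val_inj; rewrite -(ancestor_occupant p.2 (tau_enum_val p.1)).
    by rewrite -[occupant _ _]/(unfolding p) pq ancestor_occupant ?tau_enum_val.
  apply: connect_trans (unfolding_connect q).
  rewrite fiber_edge_connect_sym; last exact: product_tree_sym.
  by rewrite -pq -epq; apply: unfolding_connect.
- case: p q => [j x] [l y]; rewrite (@product_tree_edge a #|G| b) => /andP[/eqP/= <-].
  case/orP=> /(unfolding_child j) => [//|[->|]]; first by left.
  by rewrite adj_sym; right.
- have [|/ltnW] := leqP (tau u) (tau v); first exact: unfolding_adj.
  rewrite adj_sym in uv; case/(unfolding_adj uv)=> p [q [pq pv qu]].
  exists q, p; split=> //; rewrite product_tree_sym product_complete_edge.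
  by rewrite eq_sym [_.2 == _]eq_sym -product_complete_edge.
Qed.

End Unfolding.

(** * The characterization of PSD throttling *)

Lemma forcing_sequence_contraction_map (G : sgraph) (D : nat -> {set G}) b :
  forcing_sequence D -> D b = [set: G] ->
  exists f, contraction_map (G := G)
    (box_product (complete_graph #|D 0|) (kary_tree #|G| b)) f.
Proof.
move=> fD DT.
(* [tau w] is the first time [w] is blue; since [D] increases, it determines every [D s]. *)
have /choice[tau tauP] w : exists n, forall s, (w \in D s) = (n <= s).
  have ex : exists s, w \in D s by exists b; rewrite DT inE.
  have [n wn minn] := ex_minnP ex; exists n => s; apply/idP/idP; first exact: minn.
  by move=> ns; apply: (subsetP (forcing_sequence_sub fD ns)).
have DE s : D s = [set v | tau v <= s] by apply/setP => v; rewrite inE tauP.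
have /choice[par parP] w : exists u, if tau w is s.+1 then psd_force (D s) u w else u = w.
  case E: (tau w) => [|s]; first by exists w.
  by apply: (fD s).2; rewrite tauP E ?ltnn.
rewrite DE; exists (@unfolding _ tau par b); apply: unfolding_contraction_map => [w w0|w|w].
- by have := parP w; rewrite w0.
- by have := parP w; case: (tau w) => // s; rewrite DE.
- by rewrite -tauP DT inE.
Qed.

Unset Implicit Arguments.

Theorem theorem2p10 (G : sgraph) (t : nat) (G_nonempty : 0 < #|G|)
    (t_pos : 0 < t) :
  th_plus G <= t <->
  exists a k b : nat,
    [/\ 0 < a, 0 < k, a + b = t &
        obtained_from G (box_product (complete_graph a) (kary_tree k b))].
Proof.
split=> [/th_plus_leP[D [b [fD Db le_t]]]|[a [k [b [_ _ <- obt]]]]]; last first.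
  have [//|||f cf] := obtained_from_contraction_map _ _ _ obt.
  - exact: product_tree_sym.
  - exact: product_tree_irrefl.
  exact: th_plus_contraction_map cf.
(* Forces come from blue vertices, so an empty initial set would stay empty. *)
have D0 : 0 < #|D 0|.
  rewrite card_gt0; apply: contraTneq G_nonempty => D0.
  have Ds s : D s = set0.
    elim: s => // s Ds; apply/setP => w; rewrite inE; apply/negP => wD.
    by have [|u /psd_forceP[]] := (fD s).2 w wD; rewrite Ds inE.
  by rewrite -cardsT -Db Ds cards0.
(* The sequence stays full after time [b], so the height can be raised until the sum is exactly
   [t]. *)
have bt : b <= t - #|D 0| by rewrite leq_subRL // (leq_trans (leq_addr _ _) le_t).
have DT : D (t - #|D 0|) = [set: G].
  by apply/eqP; rewrite eqEsubset subsetT -Db forcing_sequence_sub.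
have [f cf] := forcing_sequence_contraction_map fD DT.
exists #|D 0|, #|G|, (t - #|D 0|); split=> //.
  by rewrite subnKC // (leq_trans (leq_addr _ _) le_t).
apply: contraction_map_obtained_from cf => //; exact: product_tree_irrefl.
Qed.
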